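(* Let $n\ge1$ and let $f:\mathbb R^n\to\mathbb R$ be three times continuously differentiable. If the Aumann-Shapley and Shapley-Shubik attribution methods agree for $f$, i.e. $z_i^{AS}(r,s,f)=z_i^{SS}(r,s,f)$ for all $r,s\in\mathbb R^n$ and all $i\in\{1,\dots,n\}$, then $f$ is the sum of a multilinear function and an additively separable function.
   Context: A function $f:\mathbb R^n\to\mathbb R$ is multilinear if $f(x)=\sum_{I\subseteq\{1,\dots,n\}} c_I\prod_{i\in I}x_i$ for some real constants $c_I$. It is additively separable if $f(x)=f_1(x_1)+\cdots+f_n(x_n)$ for some functions $f_i:\mathbb R\to\mathbb R$. The Aumann-Shapley method is $z_i^{AS}(r,s,f)=(s_i-r_i)\int_0^1\partial_i f(r+t(s-r))\,dt$. The Shapley-Shubik method is the average over all $\sigma\in S_n$ of the attributions obtained by changing the variables one at a time from $r_j$ to $s_j$ in the order given by $\sigma$ (variable $j$ is the $\sigma(j)$-th to change): $z_i^{SS}(r,s,f)=\frac1{n!}\sum_{\sigma\in S_n}\big[f(u^{\{j:\sigma(j)\le\sigma(i)\}})-f(u^{\{j:\sigma(j)<\sigma(i)\}})\big]$, where for $I\subseteq\{1,\dots,n\}$ the point $u^I\in\mathbb R^n$ has coordinates $u^I_j=s_j$ for $j\in I$ and $u^I_j=r_j$ for $j\notin I$. *)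

(* Defs.v *)
From mathcomp Require Import all_boot all_order all_algebra all_fingroup.
From mathcomp Require Import all_classical all_reals all_analysis.
Set Implicit Arguments.
Unset Strict Implicit.
Unset Printing Implicit Defensive.
Import Order.TTheory GRing.Theory Num.Theory numFieldNormedType.Exports.
Local Open Scope classical_set_scope.
Local Open Scope ring_scope.

(* Total: meaningful at [x] only when [derivable f x (delta_mx 0 i)]. *)
Definition partial (R : realType) (n : nat) (i : 'I_n) (f : 'rV[R]_n -> R)
    (x : 'rV[R]_n) : R :=
  'D_(delta_mx 0 i) f x.

Fixpoint continuously_differentiable (R : realType) (n k : nat)
    (f : 'rV[R]_n -> R) : Prop :=
  continuous f /\
  if k is k'.+1 then
    forall i : 'I_n,
      (forall x, derivable f x (delta_mx 0 i)) /\
      continuously_differentiable k' (partial i f)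
  else True.

Definition multilinear (R : realType) (n : nat) (f : 'rV[R]_n -> R) : Prop :=
  exists c : {set 'I_n} -> R,
    forall x, f x = \sum_(I : {set 'I_n}) c I * \prod_(i in I) x 0 i.

Definition additively_separable (R : realType) (n : nat)
    (f : 'rV[R]_n -> R) : Prop :=
  exists g : 'I_n -> R -> R, forall x, f x = \sum_(i < n) g i (x 0 i).

Definition aumann_shapley (R : realType) (n : nat) (i : 'I_n)
    (r s : 'rV[R]_n) (f : 'rV[R]_n -> R) : R :=
  (s 0 i - r 0 i) *
  \int[lebesgue_measure]_(t in `[0, 1]) partial i f (r + t *: (s - r)).

Definition switched (R : realType) (n : nat) (r s : 'rV[R]_n)
    (I : {set 'I_n}) : 'rV[R]_n :=
  \row_j (if j \in I then s 0 j else r 0 j).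

Definition shapley_shubik (R : realType) (n : nat) (i : 'I_n)
    (r s : 'rV[R]_n) (f : 'rV[R]_n -> R) : R :=
  (n`!%:R)^-1 * \sum_(sigma : 'S_n)
    (f (switched r s [set j | (sigma j <= sigma i)%N]%SET) -
     f (switched r s [set j | (sigma j < sigma i)%N]%SET)).

(* Main.v *)
(** Let [s] differ from [r] in the two coordinates [i] and [j] only, say
    [s = r + a e_i + b e_j].  Dividing the agreement hypothesis by [a] and letting
    [a] tend to [0] shows that the trapezoid rule computes the integral of
    [partial i f] along every segment in direction [e_j].  A continuous function
    for which the trapezoid rule is exact on all segments is affine, by additivity of the
    integral.  Hence [f (x + b e_j) - (1 - b) f x - b f (x + e_j)] has zero partial
    derivative in every direction [e_i] with [i != j], so it depends on [x_j] and [b]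
    only; subtracting its values at [x = 0], [b = x_j], from [f] for each [j] leaves
    a function that is affine in each variable, that is, a multilinear one. *)

Require Import Defs.
From mathcomp Require Import all_boot all_order all_algebra all_fingroup.
From mathcomp Require Import all_classical all_reals all_analysis.
From mathcomp Require Import ring lra.
Import Order.TTheory GRing.Theory Num.Theory numFieldNormedType.Exports.
Set Implicit Arguments.
Unset Strict Implicit.
Unset Printing Implicit Defensive.
Local Open Scope ring_scope.

(** * Integrals over segments: the trapezoid rule and dependence on a parameter *)

Section Integral.
Local Open Scope classical_set_scope.
Local Open Scope ring_scope.
Context {R : realType}.
Notation mu := (@lebesgue_measure R).
Implicit Types (f : R -> R) (a b c d t : R).

Lemma continuous_integrable f a b : continuous f ->
  mu.-integrable `[a, b] (EFin \o f).
Proof.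
move=> f_cont; apply: continuous_compact_integrable; first exact: segment_compact.
exact: continuous_subspaceT.
Qed.

Lemma affine_continuous c b : continuous (fun t : R => c + t * b).
Proof. by move=> t; apply: cvgD; [exact: cvg_cst|apply: cvgM => //; exact: cvg_cst]. Qed.

Lemma Rintegral_affine f c d : c < d -> continuous f ->
  (d - c) * \int[mu]_(t in `[0, 1]) f (c + t * (d - c)) = \int[mu]_(t in `[c, d]) f t.
Proof.
move=> cd f_cont.
have aff_cont := @affine_continuous c (d - c).
have derE : derive1 (fun t : R => c + t * (d - c)) = cst (d - c).
  apply/funext => t; rewrite derive1E.
  have : is_derive t (1 : R) (cst c + id * cst (d - c)) (d - c).
    by apply: is_derive_eq; rewrite scaler0 add0r add0r [_ *: _]mulr1.
  by case.
have := @integration_by_substitution_increasing R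
  (fun t => c + t * (d - c)) f 0 1 ler01.
rewrite mul0r addr0 mul1r (addrC c) subrK => subst.
rewrite [RHS]/Rintegral subst; last first.
- exact: continuous_subspaceT.
- split.
  + by move=> t _; apply/derivable1_diffP/differentiableD => //; exact/derivable1_diffP.
  + exact/cvg_at_right_filter/aff_cont.
  + exact/cvg_at_left_filter/aff_cont.
- by rewrite derE; exact: is_cvg_cst.
- by rewrite derE; exact: is_cvg_cst.
- by rewrite derE => t _; exact: cvg_cst.
- by move=> s t _ _ st; rewrite ltrD2l ltr_pM2r // subr_gt0.
rewrite derE mulrC -RintegralZr //.
apply: (@continuous_integrable (fun t => f (c + t * (d - c)))) => t.
by apply: continuous_comp; [exact: aff_cont|exact: f_cont].
Qed.

Lemma trapezoid_affine f : continuous f ->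
    (forall c b, \int[mu]_(t in `[0, 1]) f (c + t * b) = (f c + f (c + b)) / 2) ->
  forall b, f b = (1 - b) * f 0 + b * f 1.
Proof.
move=> f_cont trap.
have area c d : c < d -> \int[mu]_(t in `[c, d]) f t = (d - c) * ((f c + f d) / 2).
  by move=> cd; rewrite -Rintegral_affine // trap (addrC c) subrK.
(* Cutting the integral over [[c, d]] at [m] and evaluating all three integrals by [area] leaves a
   linear relation between [f c], [f m] and [f d]: the point at [m] lies on the chord. *)
have chord c m d : c < m -> m < d -> (d - c) * f m = (d - m) * f c + (m - c) * f d.
  move=> cm md; have cd := lt_trans cm md.
  have := @Rintegral_itvB R f (BLeft c) (BRight d) m (continuous_integrable c d f_cont).
  rewrite !bnd_simp => /(_ (ltW cm) (ltW md)).
  rewrite Rintegral_itv_obnd_cbnd; last first.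
    apply: integrableS (continuous_integrable m d f_cont) => //.
    exact: subset_itv_oc_cc.
  rewrite !area //; nra.
(* [chord] is applied to 0, 1 and [b], taken in increasing order. *)
move=> b; have [b0|b0|->] := ltgtP b 0; last by ring.
  have := chord _ _ _ b0 ltr01; lra.
have [b1|b1|->] := ltgtP b 1; last by ring.
  have := chord _ _ _ b0 b1; lra.
have := chord _ _ _ ltr01 b1; lra.
Qed.

(** Dominated convergence: [F] is bounded on a compact box around the segment [a = 0], and a
    constant is integrable on [[0, 1]]. *)
Lemma continuous_Rintegral01 (F : R * R -> R) : continuous F ->
  \int[mu]_(t in `[0, 1]) F (a, t) @[a --> (0 : R)] --> \int[mu]_(t in `[0, 1]) F (0, t).
Proof.
move=> F_cont.
have [M [_ F_bnd]] : bounded_set (F @` (`[-1, 1] `*` `[0, 1])).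
  apply: (@compact_bounded R R^o); apply: continuous_compact; first exact: continuous_subspaceT.
  by apply: compact_setX; exact: segment_compact.
have Fa_cont a : continuous (fun t => F (a, t)).
  move=> t; apply: (@continuous_comp _ _ _ (fun t => (a, t)) F); last exact: F_cont.
  exact: (cvg_pair (cvg_cst a) cvg_id).
suff : {in `](-1 : R), 1[%classic,
    continuous (fun a => \int[mu]_(t in `[0, 1]) F (a, t))}.
  by move=> /(_ 0); apply; rewrite inE /= in_itv /=; apply/andP; split; lra.
(* Boundedness only says that every real strictly above [M] is a bound, hence [M + 1]. *)
apply: (@continuity_under_integral R _ _ mu (fun a t => F (a, t)) `[0, 1]%classic _
  (-1) 1 _ _ (cst (M + 1))) => //=.
- by move=> a _; exact: continuous_integrable.
- apply: aeW => t _ a _; apply: (@continuous_comp _ _ _ (fun a => (a, t)) F); last exact: F_cont.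
  exact: (cvg_pair cvg_id (cvg_cst t)).
- by apply: (@continuous_integrable (cst (M + 1))) => t; exact: cvg_cst.
- move=> a a_itv; apply: aeW => t t01; apply: F_bnd; first by rewrite ltrDl.
  exists (a, t) => //; split => //=.
  by move: a_itv; rewrite /= !in_itv /= => /andP[/ltW -> /ltW ->].
Qed.

End Integral.

(* Composition with the transposition of [i] and [j] exchanges the two cases. *)
Lemma sum_perm_lt (R : realType) (n : nat) (i j : 'I_n) (A B : R) : i != j ->
  \sum_(s : 'S_n) (if (s j < s i)%N then A else B) = n`!%:R * ((A + B) / 2).
Proof.
move=> neq_ij; set F := fun s : 'S_n => if (s j < s i)%N then A else B.
have swapF : \sum_s F s = \sum_s F (tperm i j * s)%g.
  by rewrite [LHS](reindex_inj (mulgI (tperm i j))).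
have sumFF : \sum_s F s + \sum_s F s = n`!%:R * (A + B).
  rewrite [X in _ + X]swapF -big_split /= -card_Sn -[X in X%:R]cardsT.
  rewrite mulr_natl -sumr_const; apply: eq_big => [s|s _].
    by rewrite !inE.
  rewrite /F !permM tpermL tpermR.
  have : s i != s j by rewrite (inj_eq perm_inj).
  case: (ltngtP (s i) (s j)) => [_ _|_ _|/val_inj ->]; last by rewrite eqxx.
    by rewrite addrC.
  by [].
lra.
Qed.

(** * Functions affine in each coordinate are multilinear *)

Section Coordinates.
Context {R : realType} {n : nat}.
Implicit Types (x y r s : 'rV[R]_n) (i j k : 'I_n) (f m : 'rV[R]_n -> R) (a b : R).

Notation e_ := (delta_mx (0 : 'I_1)).

Definition setcoord x j b : 'rV[R]_n := x + (b - x 0 j) *: e_ j.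

Lemma setcoordE x j b k : setcoord x j b 0 k = if k == j then b else x 0 k.
Proof.
rewrite !mxE eqxx /=; case: eqP => [->|_]; first by rewrite mulr1; ring.
by rewrite mulr0 addr0.
Qed.

Lemma setcoordC x i j a b : i != j ->
  setcoord (setcoord x i a) j b = setcoord (setcoord x j b) i a.
Proof.
move=> neq_ij; apply/rowP => k; rewrite !setcoordE.
by case: (altP (k =P j)) => [->|//]; rewrite eq_sym (negbTE neq_ij).
Qed.

Lemma setcoord_setcoord x j a b : setcoord (setcoord x j a) j b = setcoord x j b.
Proof. by apply/rowP => k; rewrite !setcoordE; case: eqP. Qed.

Lemma setcoord_id x j : setcoord x j (x 0 j) = x.
Proof. by rewrite /setcoord subrr scale0r addr0. Qed.

(** The coordinates of [x] listed in [s] are overwritten by those of [y] one at a time, which never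
    changes [f]. *)
Lemma eq_setcoord (s : seq 'I_n) f x y :
    (forall i z a, i \in s -> f (setcoord z i a) = f z) ->
    (forall k, k \notin s -> x 0 k = y 0 k) ->
  f x = f y.
Proof.
elim: s x => [|i s IHs] x f_inv eq_xy.
  by congr (f _); apply/rowP => k; apply: eq_xy.
rewrite -(f_inv i x (y 0 i)) ?mem_head //.
apply: IHs => [k z a ks|k ks]; first by rewrite f_inv // inE ks orbT.
rewrite setcoordE; case: (eqVneq k i) => [->//|neq_ki].
by rewrite eq_xy // inE negb_or neq_ki.
Qed.

(** Interpolation from the nodes 0 and 1 expresses affinity in each coordinate without naming
    coefficients. *)
Definition separately_affine m := forall x j,
  m x = (1 - x 0 j) * m (setcoord x j 0) + x 0 j * m (setcoord x j 1).

Lemma separately_affine_restrict m j b : separately_affine m ->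
  separately_affine (fun x => m (setcoord x j b)).
Proof.
move=> m_aff x k; case: (eqVneq k j) => [->|neq_kj].
  by rewrite !setcoord_setcoord; ring.
rewrite !(@setcoordC x k j _ b neq_kj).
have := m_aff (setcoord x j b) k; rewrite !setcoordE (negbTE neq_kj).
by move=> ->.
Qed.

Lemma separately_affineB m1 m2 : separately_affine m1 -> separately_affine m2 ->
  separately_affine (fun x => m1 x - m2 x).
Proof. by move=> m1_aff m2_aff x j; rewrite (m1_aff x j) (m2_aff x j); ring. Qed.

Lemma separately_affine_multilinear m : separately_affine m -> multilinear m.
Proof.
(* Induction on a list [s] of the coordinates on which [m] may depend, recording that the
   coefficients live on subsets of [s]. *)
suff supp (s : seq 'I_n) : uniq s -> forall m, separately_affine m ->
    (forall x j b, j \notin s -> m (setcoord x j b) = m x) ->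
    exists2 c : {set 'I_n} -> R,
      (forall (I : {set 'I_n}) j, j \in I -> j \notin s -> c I = 0) &
      forall x, m x = \sum_(I : {set 'I_n}) c I * \prod_(i in I) x 0 i.
  move=> m_aff; have [|c _ mE] := supp (enum 'I_n) (enum_uniq _) m m_aff; last by exists c.
  by move=> x j b; rewrite mem_enum.
elim: s => [_|j s IHs /= /andP[js s_uniq]] {}m m_aff m_inv.
  exists (fun I => if I == finset.set0 then m 0 else 0) => [I i iI _|x].
    by case: eqP iI => // ->; rewrite inE.
  rewrite (bigD1 finset.set0) //= eqxx finset.big_set0 mulr1 big1 ?addr0; last first.
    by move=> I /negbTE ->; rewrite mul0r.
  apply: (@eq_setcoord (enum 'I_n)) => [i z a _|k]; first exact: m_inv.
  by rewrite mem_enum.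
have aff0 := @separately_affine_restrict m j 0 m_aff.
have aff1 := @separately_affine_restrict m j 1 m_aff.
have inv b x k a : k \notin s ->
    m (setcoord (setcoord x k a) j b) = m (setcoord x j b).
  move=> ks; case: (eqVneq k j) => [->|neq_kj]; first by rewrite setcoord_setcoord.
  by rewrite setcoordC // m_inv // inE negb_or neq_kj.
have [|c0 c0_supp mE0] := IHs s_uniq _ aff0; first exact: inv.
have [|c1 c1_supp mE1] := IHs s_uniq _ (separately_affineB aff1 aff0).
  by move=> x k a ks; rewrite !inv.
(* In the variable [x_j], [c0] expands the constant term and [c1] the slope; neither depends on
   [x_j]. *)
exists (fun I : {set 'I_n} => if j \in I then c1 (I :\ j) else c0 I) => [I k kI|x].
  rewrite inE negb_or => /andP[neq_kj ks]; case: ifP => _; last exact: c0_supp ks.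
  by apply: (c1_supp _ k) => //; rewrite !inE neq_kj.
have -> : m x = m (setcoord x j 0) + x 0 j * (m (setcoord x j 1) - m (setcoord x j 0)).
  by rewrite (m_aff x j); ring.
(* Since [j] is not in [s], both [c0] and [c1] vanish on sets containing [j]. On the other sets,
   adjoining [j] matches the terms of [c1] with the monomials divisible by [x_j]. *)
rewrite mE1 mE0 [RHS](bigID (fun I : {set 'I_n} => j \in I)) /= addrC.
congr (_ + _); last first.
  rewrite [in LHS](bigID (fun I : {set 'I_n} => j \in I)) /= big1 ?add0r.
    rewrite mulr_sumr [RHS](reindex_onto (fun I => j |: I) (fun I => I :\ j)) /=; last first.
      by move=> I jI; rewrite finset.setD1K.
    apply: eq_big => [I|I jI].
      rewrite finset.setU11 /=; apply/idP/eqP => [jI|<-]; first by rewrite finset.setU1K.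
      by rewrite !inE eqxx.
    by rewrite finset.setU11 finset.setU1K // big_setU1 //= mulrCA.
  by move=> I jI; rewrite (c1_supp _ j) ?mul0r.
rewrite (bigID (fun I : {set 'I_n} => j \in I)) /= big1 ?add0r.
  by apply: eq_bigr => I /negbTE ->.
by move=> I jI; rewrite (c0_supp _ j) ?mul0r.
Qed.

End Coordinates.

(** * Both attributions when only two coordinates move *)

Section TwoCoordinates.
Local Open Scope classical_set_scope.
Local Open Scope ring_scope.
Context {R : realType} {n : nat}.
Implicit Types (x y : 'rV[R]_n) (i j k : 'I_n) (f : 'rV[R]_n -> R) (a b t : R).

Notation e_ := (delta_mx (0 : 'I_1)).
Notation mu := (@lebesgue_measure R).

(** Only the relative order of [i] and [j] matters, as the other coordinates do not move: [A] is the
    increment when [j] changes first, [B] when [i] does, and each case covers half of the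
    permutations. *)
Lemma shapley_shubik_two f i j x a b : i != j ->
  shapley_shubik i x (x + (a *: e_ i + b *: e_ j)) f =
  ((f (x + b *: e_ j + a *: e_ i) - f (x + b *: e_ j)) + (f (x + a *: e_ i) - f x)) / 2.
Proof.
move=> neq_ij; rewrite /shapley_shubik.
set A := f (x + b *: e_ j + a *: e_ i) - f (x + b *: e_ j).
set B := f (x + a *: e_ i) - f x.
have nfact : (n`!%:R : R) != 0 by rewrite pnatr_eq0 -lt0n fact_gt0.
rewrite -[RHS](mulKf nfact) -(sum_perm_lt A B neq_ij); congr (_ * _).
have neq_ji : j != i by rewrite eq_sym.
apply: eq_bigr => s _; case: ltnP => ltij; rewrite /A /B; congr (f _ - f _).
- apply/rowP => k; rewrite !mxE finset.inE.
  case: (eqVneq k i) => [->|neq_ki]; first by rewrite leqnn eqxx (negbTE neq_ij) /=; ring.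
  case: (eqVneq k j) => [->|neq_kj]; first by rewrite (ltnW ltij) eqxx /=; ring.
  by case: ifP => _; rewrite eqxx /=; ring.
- apply/rowP => k; rewrite !mxE finset.inE.
  case: (eqVneq k i) => [->|neq_ki]; first by rewrite ltnn eqxx (negbTE neq_ij) /=; ring.
  case: (eqVneq k j) => [->|neq_kj]; first by rewrite ltij eqxx /=; ring.
  by case: ifP => _; rewrite eqxx /=; ring.
- apply/rowP => k; rewrite !mxE finset.inE.
  case: (eqVneq k i) => [->|neq_ki]; first by rewrite leqnn eqxx (negbTE neq_ij) /=; ring.
  case: (eqVneq k j) => [->|neq_kj]; last by case: ifP => _; rewrite eqxx /=; ring.
  have : s i != s j by rewrite (inj_eq perm_inj).
  by move=> neq_s; rewrite leqNgt ltn_neqAle ltij neq_s eqxx /=; ring.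
- apply/rowP => k; rewrite !mxE finset.inE.
  case: (eqVneq k i) => [->|neq_ki]; first by rewrite ltnn.
  case: (eqVneq k j) => [->|neq_kj]; last by case: ifP => _; rewrite ?eqxx /=; ring.
  by rewrite ltnNge ltij.
Qed.

Lemma aumann_shapley_two f i j x a b : i != j ->
  aumann_shapley i x (x + (a *: e_ i + b *: e_ j)) f =
  a * \int[mu]_(t in `[0, 1]%classic) partial i f (x + t *: (a *: e_ i + b *: e_ j)).
Proof.
move=> neq_ij; rewrite /aumann_shapley.
have -> : (x + (a *: e_ i + b *: e_ j)) 0 i - x 0 i = a.
  by rewrite !mxE !eqxx (negbTE neq_ij) /=; ring.
by rewrite (addrC x) addrK.
Qed.

Lemma partial_cvg f i x : derivable f x (e_ i) ->
  a^-1 * (f (x + a *: e_ i) - f x) @[a --> 0^'] --> partial i f x.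
Proof.
move=> df; rewrite /partial /derive.
rewrite (_ : (fun a => _) = (fun h : R => h^-1 *: ((f \o shift x) (h *: e_ i) - f x))) //.
by apply/funext => h /=; rewrite (addrC x).
Qed.

Lemma is_derive_line f i x t : derivable f (x + t *: e_ i) (e_ i) ->
  is_derive t 1 (fun u => f (x + u *: e_ i)) (partial i f (x + t *: e_ i)).
Proof.
move=> df.
have lineE : (fun h : R => h^-1 *: (((fun u => f (x + u *: e_ i)) \o shift t) (h *: 1)
      - f (x + t *: e_ i))) =
    (fun h : R => h^-1 *: ((f \o shift (x + t *: e_ i)) (h *: e_ i) - f (x + t *: e_ i))).
  apply/funext => h /=; congr (_ *: (f _ - _)).
  by rewrite [h *: 1]mulr1 scalerDl addrCA.
by split; rewrite /derivable /partial /derive lineE.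
Qed.

End TwoCoordinates.

(** * Consequences of the agreement of the two methods *)

Section Agreement.
Local Open Scope classical_set_scope.
Local Open Scope ring_scope.
Context {R : realType} {n : nat} {f : 'rV[R]_n -> R}.
Implicit Types (x y : 'rV[R]_n) (i j k : 'I_n) (a b t : R).

Notation e_ := (delta_mx (0 : 'I_1)).
Notation mu := (@lebesgue_measure R).

Hypothesis f_derivable : forall i x, derivable f x (e_ i).
Hypothesis partial_continuous : forall i, continuous (partial i f).
Hypothesis agree : forall r s i, aumann_shapley i r s f = shapley_shubik i r s f.

Lemma partial_trapezoid i j x b : i != j ->
  \int[mu]_(t in `[0, 1]%classic) partial i f (x + (t * b) *: e_ j) =
  (partial i f x + partial i f (x + b *: e_ j)) / 2.
Proof.
move=> neq_ij.
(* [F (a, t)] is the Aumann-Shapley integrand for the displacement [a e_i + b e_j]; its joint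
   continuity lets [a] tend to 0 under the integral. *)
pose F (u : R * R) := partial i f (x + u.2 *: (u.1 *: e_ i + b *: e_ j)).
have F_cont : continuous F.
  move=> u; apply: (@continuous_comp _ _ _
    (fun u : R * R => x + u.2 *: (u.1 *: e_ i + b *: e_ j)) (partial i f)).
    apply: cvgD; first exact: cvg_cst.
    apply: cvgZ; first exact: cvg_snd.
    apply: cvgD; last exact: cvg_cst.
    by apply: cvgZ; [exact: cvg_fst|exact: cvg_cst].
  exact: partial_continuous.
have -> : \int[mu]_(t in `[0, 1]%classic) partial i f (x + (t * b) *: e_ j) =
    \int[mu]_(t in `[0, 1]%classic) F (0, t).
  by apply: eq_Rintegral => t _; rewrite /F /= scale0r add0r scalerA.
have lim_int : \int[mu]_(t in `[0, 1]%classic) F (a, t) @[a --> (0:R)^'] -->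
    \int[mu]_(t in `[0, 1]%classic) F (0, t).
  apply: cvg_trans (continuous_Rintegral01 F_cont).
  by apply: cvg_app; exact: nbhs_dnbhs.
apply: (cvg_unique _ lim_int) => //.
rewrite addrC.
have lim_SS : (a^-1 * (f (x + b *: e_ j + a *: e_ i) - f (x + b *: e_ j)) +
    a^-1 * (f (x + a *: e_ i) - f x)) / 2 @[a --> 0^'] -->
    (partial i f (x + b *: e_ j) + partial i f x) / 2.
  by apply: cvgM; [apply: cvgD; apply: partial_cvg|exact: cvg_cst].
(* On a punctured neighbourhood of 0 the factor [a] cancels from the agreement hypothesis, so both
   limits are those of the same function. *)
apply: cvg_trans lim_SS; apply: near_eq_cvg; near=> a.
have a0 : a != 0 by near: a; exact: nbhs_dnbhs_neq.
apply: (mulfI a0).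
rewrite /F /= -aumann_shapley_two // agree shapley_shubik_two //.
by field.
Unshelve. all: by end_near. Qed.

Lemma partial_affine i j x b : i != j ->
  partial i f (x + b *: e_ j) = (1 - b) * partial i f x + b * partial i f (x + e_ j).
Proof.
move=> neq_ij.
have := @trapezoid_affine R (fun c => partial i f (x + c *: e_ j)) _ _ b.
rewrite scale0r addr0 scale1r; apply.
  move=> c; apply: (@continuous_comp _ _ _ (fun c : R => x + c *: e_ j) (partial i f)).
    by apply: cvgD; [exact: cvg_cst|apply: cvgZ; [exact: cvg_id|exact: cvg_cst]].
  exact: partial_continuous.
move=> c d; rewrite (scalerDl (e_ j) c d) addrA -(partial_trapezoid (x + c *: e_ j) d neq_ij).
by apply: eq_Rintegral => t _; rewrite scalerDl addrA.
Qed.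

Definition affine_defect j b x : R :=
  f (x + b *: e_ j) - (1 - b) * f x - b * f (x + e_ j).

Lemma affine_defect_setcoord i j b x a : i != j ->
  affine_defect j b (setcoord x i a) = affine_defect j b x.
Proof.
move=> neq_ij; rewrite /setcoord; move: (a - _) => {}a.
pose g t := f (x + b *: e_ j + t *: e_ i) - (1 - b) * f (x + t *: e_ i)
  - b * f (x + e_ j + t *: e_ i).
have gE t : affine_defect j b (x + t *: e_ i) = g t.
  by rewrite /affine_defect /g -!(addrAC _ (t *: _)).
rewrite gE -[in RHS](addr0 x) -(scale0r (e_ i)) gE.
apply: is_derive_0_is_cst => t.
have d y : is_derive t 1 (fun u => f (y + u *: e_ i)) (partial i f (y + t *: e_ i)).
  exact: is_derive_line.
have := is_deriveB (is_deriveB (d (x + b *: e_ j)) (is_deriveZ (1 - b) (d x)))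
  (is_deriveZ b (d (x + e_ j))).
(* The derivative of [g] is the affine defect of [partial i f] along [e_j], which is zero by
   [partial_affine]. *)
rewrite (addrAC x (b *: _)) (addrAC x (e_ j)) (partial_affine _ _ neq_ij) /=.
set v := (X in is_derive _ _ _ X); suff -> : v = 0 by [].
by rewrite /v /GRing.scale /=; ring.
Qed.

Lemma agree_decomposition :
  exists g h : 'rV[R]_n -> R,
    [/\ multilinear g, additively_separable h & forall x, f x = g x + h x].
Proof.
pose g j b := affine_defect j b 0.
(* Vanishing at the nodes 0 and 1 means that subtracting [g j] leaves the interpolation values in
   direction [j] unchanged. *)
have g0 j : g j 0 = 0 by rewrite /g /affine_defect scale0r !addr0; ring.
have g1 j : g j 1 = 0 by rewrite /g /affine_defect scale1r; ring.
pose h x := \sum_j g j (x 0 j).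
exists (fun x => f x - h x), h; split; last by move=> x; rewrite subrK.
  apply: separately_affine_multilinear => x j.
  have hE b : h (setcoord x j b) = g j b + \sum_(k | k != j) g k (x 0 k).
    rewrite /h (bigD1 j) //= setcoordE eqxx; congr (_ + _).
    by apply: eq_bigr => k /negbTE neq_kj; rewrite setcoordE neq_kj.
  have hxE := hE (x 0 j); rewrite setcoord_id in hxE.
  (* [setcoord x j 0] and the origin share their [j]-th coordinate, the only one on which the defect
     depends. *)
  have gE : affine_defect j (x 0 j) (setcoord x j 0) = g j (x 0 j).
    apply: (@eq_setcoord _ _ [seq k <- enum 'I_n | k != j] (affine_defect j _)) => [i z a|k].
      by rewrite mem_filter => /andP[neq_ij _]; exact: affine_defect_setcoord.
    rewrite mem_filter mem_enum andbT negbK => /eqP ->.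
    by rewrite setcoordE eqxx mxE.
  (* Unfolded, [gE] is the interpolation identity for [f] minus the [j]-th term of [h]. The other
     terms of [h] are constant along [e_j], and the weights sum to 1. *)
  have := gE; rewrite /affine_defect.
  have -> : setcoord x j 0 + x 0 j *: e_ j = x.
    by rewrite /setcoord sub0r scaleNr subrK.
  have -> : setcoord x j 0 + e_ j = setcoord x j 1.
    by rewrite /setcoord sub0r (addrC 1) scalerDl scale1r addrA.
  rewrite hxE !hE g0 g1 => <-; ring.
by exists g.
Qed.

End Agreement.

Theorem theorem4p4 (R : realType) (n : nat) (f : 'rV[R]_n -> R) :
  (1 <= n)%N ->
  continuously_differentiable 3 f ->
  (forall (r s : 'rV[R]_n) (i : 'I_n),
     aumann_shapley i r s f = shapley_shubik i r s f) ->
  exists g h : 'rV[R]_n -> R,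
    [/\ multilinear g, additively_separable h & forall x, f x = g x + h x].
Proof.
move=> _ [_ f_C3] agree.
by apply: agree_decomposition => // i; have [? []] := f_C3 i.
Qed.
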